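(* Let $p$ be a prime and let $W_p$ be the set of all $x\in\mathbb{C}_p$ such that $x\notin\mathcal{Z}_p$, or $x\in\mathcal{Z}_p$ and $\overline{x}\notin\mathbb{F}_p$. For all $x\in W_p$, $$\operatorname{Log}\Gamma_p(x)=\operatorname{Log}\Gamma_{\mathrm{D}}(x).$$
   Context: $\mathbb{C}_p$ is the completion of the algebraic closure of $\mathbb{Q}_p$, with absolute value $|\cdot|_p$; $\mathcal{Z}_p=\{x\in\mathbb{C}_p: |x|_p\le 1\}$ is its ring of integers. For $x\in\mathcal{Z}_p$, $\overline{x}$ denotes its image in the residue field of $\mathbb{C}_p$ (isomorphic to $\overline{\mathbb{F}}_p$), which contains $\mathbb{F}_p$. One has $W_p\subset\mathbb{C}_p\setminus\mathbb{Z}_p$. $\log_p:\mathbb{C}_p^*\to\mathbb{C}_p$ is the Iwasawa $p$-adic logarithm: the homomorphism given by the usual power series of the logarithm on $\{|x-1|_p<1\}$ and normalized by $\log_p(p)=0$. The Volkenborn integral of $g:\mathbb{Z}_p\to\mathbb{C}_p$ is $\int_{\mathbb{Z}_p}g(t)\,dt:=\lim_{N\to\infty}p^{-N}\sum_{j=0}^{p^N-1}g(j)$ when the limit exists. $\chi:\mathbb{C}_p\to\{0,1\}$ is the characteristic function of $\{x\in\mathbb{C}_p:|x|_p\ge1\}$. The function $\operatorname{Log}\Gamma_p:\mathbb{C}_p\to\mathbb{C}_p$ is $\operatorname{Log}\Gamma_p(x):=\int_{\mathbb{Z}_p}(x+t)\big(\log_p(x+t)-1\big)\chi(x+t)\,dt$,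 the integrand being $0$ whenever $|x+t|_p<1$. Diamond's function $\operatorname{Log}\Gamma_{\mathrm{D}}:\mathbb{C}_p\setminus\mathbb{Z}_p\to\mathbb{C}_p$ is $\operatorname{Log}\Gamma_{\mathrm{D}}(x):=\int_{\mathbb{Z}_p}(x+t)\big(\log_p(x+t)-1\big)\,dt$. *)

(* Defs.v *)
From HB Require Import structures.
From mathcomp Require Import all_boot all_order all_algebra.
From mathcomp Require Import generic_quotient ring_quotient.
From mathcomp Require Import all_classical all_reals all_analysis.

Set Implicit Arguments.
Unset Strict Implicit.
Unset Printing Implicit Defensive.

Import Order.TTheory GRing.Theory Num.Theory.
Import numFieldNormedType.Exports.

Local Open Scope classical_set_scope.
Local Open Scope ring_scope.

(* The absolute value is a separate function rather than the norm of a
   normedZmodType: the latter satisfies `|x *+ n| = `|x| *+ n, which fails for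
   non-archimedean absolute values. *)
Record nonArchField (R : realType) := NonArchField {
  naf_field : fieldType;
  naf_abs : naf_field -> R;
  naf_abs_ge0 : forall x, 0 <= naf_abs x;
  naf_abs_eq0 : forall x, naf_abs x = 0 <-> x = 0;
  naf_absM : forall x y, naf_abs (x * y) = naf_abs x * naf_abs y;
  naf_absD : forall x y, naf_abs (x + y) <= Num.max (naf_abs x) (naf_abs y) }.

Definition naf_sort (R : realType) (K : nonArchField R) : Type := naf_field K.
Coercion naf_sort : nonArchField >-> Sortclass.
HB.instance Definition _ (R : realType) (K : nonArchField R) :=
  GRing.Field.copy (naf_sort K) (naf_field K).

Definition absv (R : realType) (K : nonArchField R) (x : K) : R :=
  @naf_abs R K x.

Section NonArchTheory.
Variables (R : realType) (K : nonArchField R).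
Implicit Types x y : K.

Lemma absv_ge0 x : 0 <= absv x. Proof. exact: naf_abs_ge0. Qed.

Lemma absv0 : absv (0 : K) = 0. Proof. by apply/naf_abs_eq0. Qed.

Lemma absv_eq0 x : absv x = 0 -> x = 0.
Proof. by move/naf_abs_eq0. Qed.

Lemma absvM x y : absv (x * y) = absv x * absv y.
Proof. exact: naf_absM. Qed.

Lemma absv_ultra x y : absv (x + y) <= Num.max (absv x) (absv y).
Proof. exact: naf_absD. Qed.

Lemma absv1 : absv (1 : K) = 1.
Proof.
have n0 : absv (1 : K) != 0.
  by apply/eqP => /absv_eq0/eqP; rewrite oner_eq0.
by apply: (mulfI n0); rewrite -absvM !mulr1.
Qed.

Lemma absvN x : absv (- x) = absv x.
Proof.
rewrite -mulN1r absvM; suff -> : absv (- 1 : K) = 1 by rewrite mul1r.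
by apply/eqP; rewrite -sqrp_eq1 ?absv_ge0// expr2 -absvM mulrNN mulr1 absv1.
Qed.

Let dist x y := absv (x - y).

Let distxx x : dist x x = 0. Proof. by rewrite /dist subrr absv0. Qed.

Let dist_positivity x y : dist x y = 0 -> x = y.
Proof. by move/absv_eq0/subr0_eq. Qed.

Let dist_sym x y : dist x y = dist y x.
Proof. by rewrite /dist -absvN opprB. Qed.

Let dist_triangle y x z : dist x z <= dist x y + dist y z.
Proof.
rewrite /dist -(subrKA y); apply: le_trans (absv_ultra _ _) _.
by rewrite ge_max lerDl lerDr !absv_ge0.
Qed.

HB.instance Definition _ :=
  isMetric.Build R (naf_sort K) distxx dist_positivity dist_sym dist_triangle.
HB.instance Definition _ := isPointed.Build (naf_sort K) 0.

End NonArchTheory.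

(* |q|_p = p ^ (v_p (denominator) - v_p (numerator)) *)
Definition padic_abs (R : realType) (p : nat) (q : rat) : R :=
  if q == 0 then 0
  else p%:R ^ ((logn p `|denq q|%N)%:Z - (logn p `|numq q|%N)%:Z).

(* absK is a plain function so that this applies to rat with padic_abs. *)
Definition is_completion (R : realType) (K : fieldType) (absK : K -> R)
    (L : nonArchField R) (i : {rmorphism K -> L}) : Prop :=
  [/\ forall x, absv (i x) = absK x, dense (range i) &
    forall F : set_system L, ProperFilter F -> cauchy F -> cvg F].

Definition is_algebraic_closure (K L : fieldType) (i : {rmorphism K -> L})
    : Prop :=
  GRing.closed_field_axiom L /\ forall y : L, algebraicOver i y.

(* C_p, given together with the tower Q -> Q_p -> algebraic closure of Q_p -> C_p
   which determines it up to isometric isomorphism. *)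
Record padicComplex (R : realType) (p : nat) := PadicComplex {
  Cp_Qp : nonArchField R;
  Cp_Qpbar : nonArchField R;
  Cp_sort :> nonArchField R;
  rat_to_Qp : {rmorphism rat -> Cp_Qp};
  Qp_to_Qpbar : {rmorphism Cp_Qp -> Cp_Qpbar};
  Qpbar_to_Cp : {rmorphism Cp_Qpbar -> Cp_sort};
  Qp_completion : is_completion (padic_abs R p) rat_to_Qp;
  Qpbar_closure : is_algebraic_closure Qp_to_Qpbar;
  Qpbar_isometry : forall x, absv (Qp_to_Qpbar x) = absv x;
  Cp_completion : is_completion (@absv R Cp_Qpbar) Qpbar_to_Cp }.

Section ResidueField.
Variables (R : realType) (K : nonArchField R).

Definition unit_ball : {pred K} := fun x => absv x <= 1.

Fact unit_ball_subring : subring_closed unit_ball.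
Proof.
rewrite /unit_ball; split=> [|x y|x y]; rewrite !unfold_in.
- by rewrite absv1.
- move=> hx hy; apply: le_trans (absv_ultra _ _) _.
  by rewrite absvN ge_max hx hy.
- by move=> hx hy; rewrite absvM mulr_ile1// absv_ge0.
Qed.
HB.instance Definition _ :=
  GRing.isSubringClosed.Build K unit_ball unit_ball_subring.

Record integers := Integers { integer_val : K; _ : integer_val \in unit_ball }.
HB.instance Definition _ := [isSub for integer_val].
HB.instance Definition _ := [Choice of integers by <:].
HB.instance Definition _ := [SubChoice_isSubComNzRing of integers by <:].

Definition maximal_ideal : {pred integers} := fun x => absv (val x) < 1.

Fact maximal_ideal_idealr : idealr_closed maximal_ideal.
Proof.
rewrite /maximal_ideal; split; rewrite ?unfold_in.
- by rewrite raddf0 absv0.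
- by rewrite rmorph1 absv1 ltxx.
- move=> a u v; rewrite !unfold_in rmorphD rmorphM => hu hv.
  apply: le_lt_trans (absv_ultra _ _) _; rewrite gt_max hv andbT absvM.
  by apply: le_lt_trans hu; rewrite ler_piMl ?absv_ge0//; exact: (valP a).
Qed.
HB.instance Definition _ :=
  isIdealr.Build integers maximal_ideal maximal_ideal_idealr.

Definition residue_field := {ideal_quot maximal_ideal}.
HB.instance Definition _ := GRing.ComNzRing.on residue_field.

Definition reduction (x : integers) : residue_field := (\pi x)%qT.

(* For p the residue characteristic this is the image of the unique ring
   morphism 'F_p -> residue_field; 'F_p is encoded by representatives in nat. *)
Definition prime_subfield (p : nat) : set residue_field :=
  [set (a : nat)%:R | a in [set: 'F_p]].

End ResidueField.

Arguments integers {R} K.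
Arguments residue_field {R} K.
Arguments prime_subfield {R} K p.

(* The value of log at 0 is irrelevant: log is a morphism from the group of
   units. *)
Record is_Iwasawa_log (R : realType) (p : nat) (C : padicComplex R p)
    (log : C -> C) : Prop := {
  Iwasawa_logM : forall x y : C, x != 0 -> y != 0 ->
    log (x * y) = log x + log y;
  Iwasawa_log_series : forall x : C, absv (x - 1) < 1 ->
    [series (-1) ^+ n * (x - 1) ^+ n.+1 / n.+1%:R]_n @ \oo --> log x;
  Iwasawa_log_p : log p%:R = 0 }.

Section LogGamma.
Variables (R : realType) (p : nat) (C : padicComplex R p).

(* Z_p lies in C, and only the values of g at natural numbers are used. *)
Definition Volkenborn (g : C -> C) : C :=
  lim ((p%:R ^- N * \sum_(0 <= j < p ^ N) g j%:R) @[N --> \oo]).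

Definition chi (x : C) : C := if 1 <= absv x then 1 else 0.

Variable log : C -> C.

Definition LogGamma_p (x : C) : C :=
  Volkenborn (fun t => (x + t) * (log (x + t) - 1) * chi (x + t)).

(* Meaningful for x outside Z_p. *)
Definition LogGamma_D (x : C) : C :=
  Volkenborn (fun t => (x + t) * (log (x + t) - 1)).

End LogGamma.

Definition W (R : realType) (p : nat) (C : padicComplex R p) : set C :=
  [set x | x \notin @unit_ball R C \/
    exists2 y : integers C, val y = x & ~ prime_subfield C p (reduction y)].
Arguments W {R p} C.

(* Main.v *)
(** A natural number shift cannot push [x] into the open unit ball: if
    [|x + j| < 1] then [x] is integral and reduces to the class of [-j], which
    lies in the prime field because [|p| < 1].  Hence [chi] equals 1 at every
    point entering the Riemann sums of [Log Gamma_p], and the two sequences of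
    sums coincide term by term. *)
Require Import Defs.
From mathcomp Require Import all_boot all_order all_algebra.
From mathcomp Require Import generic_quotient ring_quotient.
From mathcomp Require Import all_classical all_reals all_analysis.

Import Order.TTheory GRing.Theory Num.Theory.

Local Open Scope classical_set_scope.
Local Open Scope ring_scope.

Lemma absv_nat_le1 (R : realType) (K : nonArchField R) (n : nat) :
  absv (n%:R : K) <= 1.
Proof.
have: (n%:R : K) \in @unit_ball R K by exact: rpred_nat.
by rewrite unfold_in.
Qed.

Lemma padic_abs_p (R : realType) (p : nat) (p_prime : prime p) :
  padic_abs R p p%:R = p%:R^-1.
Proof.
rewrite /padic_abs pnatr_eq0 gtn_eqF ?prime_gt0//.
rewrite (pmulrn (1 : rat)) numq_int denq_int /= logn1 logn_prime// eqxx.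
by rewrite sub0r exprN1.
Qed.

(** Each map of the tower from [rat] to [C] is isometric and fixes natural numbers, so the value
    [p^-1] computed in [rat] carries over to [C]. *)
Lemma absv_p_lt1 (R : realType) (p : nat) (p_prime : prime p)
    (C : padicComplex R p) : absv (p%:R : C) < 1.
Proof.
have [absC _ _] := Cp_completion C.
have [absQp _ _] := Qp_completion C.
rewrite -(rmorph_nat (Qpbar_to_Cp C)) absC -(rmorph_nat (Qp_to_Qpbar C)).
rewrite Qpbar_isometry -(rmorph_nat (rat_to_Qp C)) absQp padic_abs_p//.
by rewrite invf_lt1 ?ltr0n ?ltr1n ?prime_gt0 ?prime_gt1.
Qed.

Lemma reduction_eq_nat (R : realType) (K : nonArchField R) (y : integers K)
    (n : nat) : absv (val y - n%:R) < 1 -> reduction y = n%:R.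
Proof.
move=> yn; rewrite /reduction -(rmorph_nat (\pi_(residue_field K))%qT).
apply/eqP; rewrite -Quotient.idealrBE unfold_in /maximal_ideal.
by rewrite rmorphB rmorph_nat.
Qed.

Lemma W_absv_add_nat_ge1 (R : realType) (p : nat) (p_prime : prime p)
    (C : padicComplex R p) (x : C) (j : nat) : W C x -> 1 <= absv (x + j%:R).
Proof.
move=> xW; rewrite leNgt; apply/negP => xj_lt1.
case: xW => [/negP|[y yx]]; apply.
  (* Write [x] as [(x + j) - j]: both terms are integral. *)
  rewrite unfold_in -(addrK j%:R x); apply: le_trans (absv_ultra _ _) _.
  by rewrite ge_max absvN absv_nat_le1 ltW.
(* The class of [-j], written without negation since [p - 1] is [-1] modulo [p]. *)
exists ((p.-1 * j)%:R : 'F_p) => //.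
rewrite val_Fp_nat//; apply/esym/reduction_eq_nat; rewrite yx.
have /dvdnP[q jE] : (p %| (p.-1 * j) %% p + j)%N.
  by rewrite /dvdn modnDml -mulSnr prednK ?prime_gt0// modnMr.
(* The chosen representative plus [j] is [q * p], which is small because [p] is. *)
have -> : x - ((p.-1 * j) %% p)%:R = x + j%:R - (q * p)%:R.
  by rewrite -jE natrD opprD addrACA subrr addr0.
apply: le_lt_trans (absv_ultra _ _) _; rewrite gt_max xj_lt1 absvN natrM absvM /=.
apply: le_lt_trans (absv_p_lt1 _ _ p_prime C).
by rewrite ler_piMl ?absv_ge0 ?absv_nat_le1.
Qed.

(** The Riemann sums are then the same sequence, so their [lim] agree whether or not they
    converge. *)
Lemma eq_Volkenborn (R : realType) (p : nat) (C : padicComplex R p)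
    (f g : C -> C) :
  (forall j : nat, f j%:R = g j%:R) -> Volkenborn f = Volkenborn g.
Proof.
move=> fg; rewrite /Volkenborn; under eq_fun do under eq_bigr do rewrite fg.
by [].
Qed.

Theorem proposition5p1 (R : realType) (p : nat) (p_prime : prime p)
    (C : padicComplex R p) (log : C -> C) (log_Iwasawa : is_Iwasawa_log log)
    (x : C) (xW : W C x) :
  LogGamma_p log x = LogGamma_D log x.
Proof.
apply: eq_Volkenborn => j.
by rewrite /chi W_absv_add_nat_ge1// mulr1.
Qed.
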